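(* Let $L$ be a non-abelian finite-dimensional Lie algebra over a finite field $\mathbb{F}_q$. Then the non-commuting graph $G_L$ is Hamiltonian.
   Context: $\mathbb{F}_q$ denotes the finite field with $q$ elements. For a Lie algebra $L$, $Z(L)=\{x\in L : [x,y]=0 \text{ for all } y\in L\}$ is its centre. The non-commuting graph $G_L$ is the undirected simple graph with vertex set $L\setminus Z(L)$, in which two distinct vertices $x$ and $y$ are adjacent if and only if $[x,y]\neq 0$. A graph is Hamiltonian if it has a cycle that visits each vertex exactly once. *)

(* Defs.v *)
From HB Require Import structures.
From mathcomp Require Import all_boot all_algebra all_field.

Set Implicit Arguments.
Unset Strict Implicit.
Unset Printing Implicit Defensive.

Import GRing.Theory.
Local Open Scope ring_scope.

HB.mixin Record Lmodule_isLieAlgebra (R : comNzRingType) L of GRing.Lmodule R L := {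
  lie : L -> L -> L;
  lie_linear_l : forall (a : R) (x y z : L),
    lie (a *: x + y) z = a *: lie x z + lie y z;
  lie_linear_r : forall (a : R) (x y z : L),
    lie z (a *: x + y) = a *: lie z x + lie z y;
  lie_alternating : forall x : L, lie x x = 0;
  lie_jacobi : forall x y z : L,
    lie x (lie y z) + lie y (lie z x) + lie z (lie x y) = 0
}.

#[short(type="lieAlgType")]
HB.structure Definition LieAlgebra (R : comNzRingType) :=
  {L of GRing.Lmodule R L & Lmodule_isLieAlgebra R L}.

#[short(type="vectLieAlgType")]
HB.structure Definition VectLieAlgebra (R : comNzRingType) :=
  {L of Vector R L & LieAlgebra R L}.

Definition lie_abelian (R : comNzRingType) (L : lieAlgType R) : Prop :=
  forall x y : L, lie x y = 0.

(* [finvect_type L] is [L] itself, seen as a finite type because the base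
   field is finite. *)
Definition lie_center (F : finFieldType) (L : vectLieAlgType F) :
    {set finvect_type L} :=
  [set x : finvect_type L | [forall y : finvect_type L, lie (x : L) (y : L) == 0]].

Record sgraph := SGraph {
  vertex :> finType;
  adj : rel vertex;
  adj_sym : symmetric adj;
  adj_irrefl : irreflexive adj
}.

(* A cycle of a simple graph has at least three vertices. *)
Definition hamiltonian (G : sgraph) : Prop :=
  exists c : seq G,
    [/\ (2 < size c)%N, cycle (@adj G) c, uniq c & forall v : G, v \in c].

Section NonCommutingGraph.
Variables (F : finFieldType) (L : vectLieAlgType F).

Definition nc_vertex : finType :=
  {x : finvect_type L | x \in ~: lie_center L}.

Definition nc_adj : rel nc_vertex :=
  fun x y => (x != y) && (lie (val x : L) (val y : L) != 0).

Lemma nc_adj_sym : symmetric nc_adj.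
Proof.
suff lieC (x y : L) : lie x y = - lie y x.
  by move=> x y; rewrite /nc_adj eq_sym lieC oppr_eq0.
have lieDl (u v w : L) : lie (u + v) w = lie u w + lie v w.
  by have := lie_linear_l 1 u v w; rewrite !scale1r.
have lieDr (u v w : L) : lie w (u + v) = lie w u + lie w v.
  by have := lie_linear_r 1 u v w; rewrite !scale1r.
apply/eqP; rewrite -addr_eq0; apply/eqP.
have := lie_alternating (x + y).
by rewrite lieDl !lieDr !lie_alternating add0r addr0.
Qed.

Lemma nc_adj_irrefl : irreflexive nc_adj.
Proof. by move=> x; rewrite /nc_adj eqxx. Qed.

Definition noncommuting_graph : sgraph := SGraph nc_adj_sym nc_adj_irrefl.

End NonCommutingGraph.

(* Main.v *)
Require Import Defs.
From mathcomp Require Import all_boot all_algebra all_field.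

(** The graph satisfies the degree condition of Dirac's theorem.  For a
    noncentral [x] the centraliser of [x] is a proper additive subgroup of [L],
    so a translate of it lies in its complement, and [x] fails to commute with
    at least half of the elements of [L] ([lie_centraliser_half]).  These are
    all noncentral, hence neighbours of [x], while there are at most [#|L|]
    vertices ([nc_vertex_degree]).  Moreover, if [x] and [y] do not commute,
    then [x], [y] and [x + y] are three distinct vertices.

    Hamiltonicity then follows from Ore's theorem ([ore_hamiltonian]).  List all
    vertices in a cyclic order and count the gaps, that is, the consecutive
    pairs that are not edges.  Rotate the list so that a gap joins its last
    vertex [x] to its first vertex [y].  Since [deg x + deg y] is at least the
    number of vertices, the pigeonhole principle gives consecutive vertices
    [u], [v] with [x] adjacent to [u] and [y] adjacent to [v].  Reversing the
    segment from [y] to [u] replaces the pairs [(x, y)], [(u, v)] by the edges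
    [(x, u)], [(y, v)] and keeps all other pairs, so the number of gaps drops.
    When it reaches zero, the list is a Hamiltonian cycle. *)

Set Implicit Arguments.
Unset Strict Implicit.
Unset Printing Implicit Defensive.

Import GRing.Theory.

(** * Gaps of a cyclic sequence *)

Section Gaps.
Variables (T : Type) (e : rel T).

Definition path_gaps (x : T) (s : seq T) : nat :=
  sumn (pairmap (fun a b => ~~ e a b : nat) x s).

Definition cycle_gaps (c : seq T) : nat :=
  if c is y :: s then path_gaps (last y s) c else 0.

Lemma path_gaps_cons x y s : path_gaps x (y :: s) = ~~ e x y + path_gaps y s.
Proof. by []. Qed.

Lemma path_gaps_cat x s1 s2 :
  path_gaps x (s1 ++ s2) = path_gaps x s1 + path_gaps (last x s1) s2.
Proof. by rewrite /path_gaps pairmap_cat sumn_cat. Qed.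

Lemma path_gaps_rev x s : symmetric e ->
  path_gaps (last x s) (rev (belast x s)) = path_gaps x s.
Proof.
move=> e_sym; elim: s x => //= y s IHs x.
rewrite rev_cons -cats1 path_gaps_cat IHs !path_gaps_cons addn0 addnC.
congr (~~ _ + _); rewrite e_sym; congr (e x _).
by case: s {IHs} => //= z s; rewrite rev_cons last_rcons.
Qed.

Lemma cycle_gaps_rot s1 s2 : cycle_gaps (s1 ++ s2) = cycle_gaps (s2 ++ s1).
Proof.
case: s1 s2 => [|a s1] [|b s2]; rewrite ?cats0 //=.
by rewrite !last_cat -!cat_cons !path_gaps_cat addnC.
Qed.

Lemma path_gap_split x s : ~~ path e x s ->
  exists s1 v s2, s = s1 ++ v :: s2 /\ ~~ e (last x s1) v.
Proof.
elim: s x => //= y s IHs x; rewrite negb_and.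
case: (boolP (e x y)) => [_ /= /IHs [s1 [v [s2 [-> gap_v]]]] | gap_xy _].
  by exists (y :: s1), v, s2.
by exists [::], y, s.
Qed.

Lemma cycle_gap_rot c : ~~ cycle e c ->
  exists s1 s2 y, c = s1 ++ y :: s2 /\ ~~ e (last y (s2 ++ s1)) y.
Proof.
case: c => // a s; rewrite (cycle_path a) => /path_gap_split.
case=> s1 [v [s2 [def_c gap_v]]]; exists s1, s2, v; split=> //.
move: gap_v; rewrite def_c.
by case: s1 {def_c} => [|b s1]; rewrite /= ?cats0 // !last_cat.
Qed.

(** Pigeonhole along a path: the shift by one between [belast y s] and [s] is
    what turns a common position into a consecutive pair. *)
Lemma consecutive_pigeonhole (a b : pred T) y s :
  size s < count a (belast y s) + count b s ->
  exists s1 v s2, [/\ s = s1 ++ v :: s2, a (last y s1) & b v].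
Proof.
elim: s y => //= v s IHs y.
case: (boolP (a y && b v)) => [/andP[ay bv] _ | nab]; first by exists [::], v, s.
rewrite addnACA => lt_s; have{nab lt_s} /IHs : size s < count a (belast v s) + count b s.
  by case: (a y) (b v) nab lt_s => [] [] //= _; rewrite ?add0n // => /ltnW.
by case=> s1 [w [s2 [-> aw bw]]]; exists (v :: s1), w, s2.
Qed.

(** The exchange step of Ore's theorem: [x = last v s2] and [u = last y s1]. *)
Lemma exchange_gaps y s1 v s2 : symmetric e ->
    ~~ e (last v s2) y -> e (last v s2) (last y s1) -> e y v ->
  cycle_gaps (rev (y :: s1) ++ v :: s2) < cycle_gaps (y :: s1 ++ v :: s2).
Proof.
move=> e_sym gap_xy e_xu e_yv.
rewrite lastI rev_rcons /= !last_cat /= !path_gaps_cons !path_gaps_cat.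
rewrite path_gaps_rev // !path_gaps_cons e_xu gap_xy.
have -> : last (last y s1) (rev (belast y s1)) = y.
  by case: s1 {e_xu} => //= z s1; rewrite rev_cons last_rcons.
by rewrite e_yv add0n add0n add1n ltnS leq_add2l leq_addl.
Qed.

End Gaps.

(** * Ore's theorem *)

Theorem ore_hamiltonian (G : sgraph) :
    2 < #|G| ->
    (forall x y : G, x != y -> ~~ adj x y -> #|G| <= #|adj x| + #|adj y|) ->
  hamiltonian G.
Proof.
move=> G_gt2 ore.
suff main k (c : seq G) : cycle_gaps (@adj G) c < k -> perm_eq c (enum G) ->
    exists2 c' : seq G, cycle (@adj G) c' & perm_eq c' (enum G).
  have [c cyc_c perm_c] := main _ _ (ltnSn _) (perm_refl (enum G)).
  exists c; split=> //.
  - by rewrite (perm_size perm_c) -cardE.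
  - by rewrite (perm_uniq perm_c) enum_uniq.
  - by move=> v; rewrite (perm_mem perm_c) mem_enum.
elim: k c => // k IHk c lt_c perm_c.
have [|] := boolP (cycle (@adj G) c); first by exists c.
case/cycle_gap_rot=> s1 [s2 [y [def_c]]].
move: lt_c perm_c; rewrite {}def_c cycle_gaps_rot perm_catC cat_cons.
move: (s2 ++ s1) => s {s1 s2} lt_c perm_c gap_xy.
have deg z : count (adj z) (y :: s) = #|adj z|.
  by rewrite (permP perm_c) -size_filter cardE enumT.
have size_c : (size s).+1 = #|G| by rewrite cardE -(perm_size perm_c).
have uniq_c : uniq (y :: s) by rewrite (perm_uniq perm_c) enum_uniq.
have neq_xy : last y s != y.
  case/lastP: s uniq_c size_c {lt_c perm_c gap_xy deg} => [_ sz | s x].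
    by rewrite -sz in G_gt2.
  by rewrite last_rcons /= mem_rcons inE eq_sym; case: (x =P y).
(* The last vertex is not its own neighbour, nor is the first one, so dropping
   them loses no neighbour. *)
have lt_s : size s < count (adj (last y s)) (belast y s) + count (adj y) s.
  rewrite size_c (leq_trans (ore _ _ neq_xy gap_xy)) // -!deg.
  by rewrite {1}lastI -cats1 count_cat /= !adj_irrefl !addn0 add0n.
have [s1 [v [s2 [def_s e_xu e_yv]]]] := consecutive_pigeonhole lt_s.
move: lt_c perm_c gap_xy e_xu; rewrite {}def_s last_cat /=.
move=> lt_c perm_c gap_xy e_xu.
apply: (IHk (rev (y :: s1) ++ v :: s2)).
  by rewrite (leq_trans (exchange_gaps _ gap_xy e_xu e_yv)) //; apply: adj_sym.
by apply: perm_trans perm_c; rewrite -cat_cons perm_cat2r perm_rev.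
Qed.

(** * Degrees in the non-commuting graph *)

Section Degrees.
Local Open Scope ring_scope.
Variables (F : finFieldType) (L : vectLieAlgType F).
Implicit Types x y z : L.

Lemma lieDl x y z : lie (x + y) z = lie x z + lie y z.
Proof. by have := lie_linear_l 1 x y z; rewrite !scale1r. Qed.

Lemma lieDr x y z : lie z (x + y) = lie z x + lie z y.
Proof. by have := lie_linear_r 1 x y z; rewrite !scale1r. Qed.

Definition lie_centraliser x : {set finvect_type L} :=
  [set y : finvect_type L | lie x (y : L) == 0].

(** Translation by [y] embeds the centraliser of [x] into its complement. *)
Lemma lie_centraliser_half x y : lie x y != 0 ->
  (#|lie_centraliser x| <= #|~: lie_centraliser x|)%N.
Proof.
move=> nxy; pose shift (z : finvect_type L) : finvect_type L := (z : L) + y.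
have shift_inj : injective shift by move=> u v; apply: (@addIr L).
rewrite -(card_imset _ shift_inj) subset_leq_card //.
apply/subsetP=> _ /imsetP[z cxz ->]; move: cxz; rewrite !inE => /eqP cxz.
by rewrite /shift lieDr cxz add0r.
Qed.

Lemma noncentralP (x : finvect_type L) :
  reflect (exists y, lie (x : L) y != 0) (x \in ~: lie_center L).
Proof.
by rewrite !inE negb_forall; apply: (iffP existsP) => -[y nxy]; exists y.
Qed.

Lemma noncommuting_noncentral x y : lie x y != 0 ->
  ((x : finvect_type L) \in ~: lie_center L)
    && ((y : finvect_type L) \in ~: lie_center L).
Proof.
move=> nxy; apply/andP; split; apply/noncentralP; first by exists y.
exists x; apply: contraNneq nxy => yx0.
have := lie_alternating (x + y).
by rewrite lieDl !lieDr !lie_alternating yx0 add0r !addr0 => ->.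
Qed.

Lemma nc_vertex_degree (v : nc_vertex L) :
  (#|nc_vertex L| <= 2 * #|nc_adj v|)%N.
Proof.
have /noncentralP[y nvy] := valP v.
have -> : #|nc_adj v| = #|~: lie_centraliser (val v)|.
  rewrite -(card_imset _ val_inj); apply: eq_card => z.
  apply/imsetP/idP=> [[w /andP[_ nvw] ->] | ]; first by rewrite !inE.
  rewrite !inE => nvz; have /andP[_ z_nc] := noncommuting_noncentral nvz.
  exists (Sub z z_nc) => //; apply/andP; split=> //.
  by apply: contraNneq nvz => ->; rewrite lie_alternating.
rewrite card_sig (leq_trans (max_card _)) //.
rewrite -(cardsC (lie_centraliser (val v))) mul2n -addnn leq_add2r.
exact: lie_centraliser_half nvy.
Qed.

Lemma nc_vertex_gt2 : ~ lie_abelian L -> (2 < #|nc_vertex L|)%N.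
Proof.
move=> nab; have [x [y nxy]] : exists x, exists y, lie x y != 0.
  case: (pickP [pred p : finvect_type L * finvect_type L |
                  lie (p.1 : L) (p.2 : L) != 0]) => [[x y] nxy | cL].
    by exists x, y.
  by case: nab => x y; apply/eqP; have /negbFE := cL (x, y).
have /andP[x_nc y_nc] := noncommuting_noncentral nxy.
have nxxy : lie x (x + y) != 0 by rewrite lieDr lie_alternating add0r.
have nxyy : lie (x + y) y != 0 by rewrite lieDl lie_alternating addr0.
have /andP[_ xy_nc] := noncommuting_noncentral nxxy.
have neq (u w : L) : lie u w != 0 -> u != w.
  by apply: contraNneq => ->; rewrite lie_alternating.
pose s := [:: x : finvect_type L; (x + y : L); (y : L)].
have uniq_s : uniq s.
  by rewrite /= !inE negb_or (neq _ _ nxy) (neq _ _ nxxy) (neq _ _ nxyy).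
have /allP s_nc : all [in ~: lie_center L] s by rewrite /= x_nc xy_nc y_nc.
rewrite card_sig -[2.+1]/(size s) -(card_uniqP uniq_s) subset_leq_card //.
by apply/subsetP=> z /s_nc.
Qed.

End Degrees.

Theorem proposition2p11 (F : finFieldType) (L : vectLieAlgType F) :
  ~ lie_abelian L -> hamiltonian (noncommuting_graph L).
Proof.
move=> nab; apply: ore_hamiltonian => [|x y _ _]; first exact: nc_vertex_gt2.
have half v : #|nc_vertex L| <= #|@nc_adj F L v| + #|@nc_adj F L v|.
  by rewrite addnn -mul2n; apply: nc_vertex_degree.
case: (leqP #|@nc_adj F L x| #|@nc_adj F L y|) => [le_xy | /ltnW le_yx].
  by apply: leq_trans (half x) _; rewrite leq_add2l.
by apply: leq_trans (half y) _; rewrite leq_add2r.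
Qed.
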